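(* If $G$ is a group satisfying the maximal condition on abelian subgroups, then $L(G)=\mathcal{L}(G)$. In particular, $\mathcal{L}(G)$ coincides with the Fitting subgroup of $G$.
   Context: Notation: $a^g=g^{-1}ag$, $[x,y]=x^{-1}y^{-1}xy$, $[x_1]=x_1$, $[x_1,\dots,x_n]=[[x_1,\dots,x_{n-1}],x_n]$ for $n>1$; $[x,_k y]=[x,y,\dots,y]$ with $k$ copies of $y$. An element $x\in G$ is left Engel if for every $a\in G$ there is a positive integer $k$ with $[a,_k x]=1$; $L(G)$ is the set of left Engel elements of $G$. An element $a\in G$ is randomly power Engel if for every $g\in G$ there is a sequence $a_1,\dots,a_k$ (with $k\geq 1$) of elements of $\langle a\rangle$ with $\langle a_i\rangle=\langle a\rangle$ for all $i$ such that either $[a_1^g,a_2,\dots,a_k]=1$ or $[a_1,a_2^g,\dots,a_k^g]=1$. $\mathcal{L}(G)$ is the set of randomly power Engel elements of $G$. The maximal condition on abelian subgroups: every ascending chain of abelian subgroups stabilizes. The Fitting subgroup of $G$ is the subgroup generated by all nilpotent normal subgroups of $G$. *)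

(* Defs.v *)
From mathcomp Require Import all_boot.
From mathcomp Require Import boolp classical_sets.

Set Implicit Arguments.
Unset Strict Implicit.
Unset Printing Implicit Defensive.

Local Open Scope classical_set_scope.
Local Open Scope group_scope.

Section Groups.
Variable G : groupType.
Implicit Types (x y a b g : G) (s : seq G) (A B H N : set G).

(* A subset is viewed as a collective predicate through its canonical
   [predType] structure, so that the library's [group_closed] applies. *)
Definition is_subgroup H : Prop := group_closed (mem H).

Definition gen A : set G := smallest is_subgroup A.

Definition cyc a : set G := gen [set a].

Definition is_abelian H : Prop := {in H &, forall x y, commute x y}.

Definition is_normal N : Prop := forall x g, x \in N -> x ^ g \in N.

Definition comm_subgroup A B : set G :=
  gen [set z | exists x y, [/\ x \in A, y \in B & z = [~ x, y]]].

(* [lower_central H n] is the term usually written gamma_{n+1}(H). *)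
Definition lower_central H (n : nat) : set G :=
  iter n (fun K => comm_subgroup K H) H.

Definition is_nilpotent H : Prop := exists n, lower_central H n = [set 1].

Definition fitting : set G :=
  gen (\bigcup_(N in [set N | [/\ is_subgroup N, is_normal N
                                & is_nilpotent N]]) N).

Definition max_abelian_subgroups : Prop :=
  forall A_ : nat -> set G,
    (forall n, is_subgroup (A_ n) /\ is_abelian (A_ n)) ->
    (forall n, A_ n `<=` A_ n.+1) ->
    exists m, forall n, (m <= n)%N -> A_ n = A_ m.

(* The left-normed commutator [x, s_0, s_1, ...]; it is x when s is empty. *)
Definition lncomm x s : G := foldl commg x s.

Definition left_Engel x : Prop :=
  forall a, exists2 k, (0 < k)%N & lncomm a (nseq k x) = 1.

(* The sequence a_1, ..., a_k with k >= 1 is a1 :: s. *)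
Definition randomly_power_Engel a : Prop :=
  forall g, exists (a1 : G) (s : seq G),
    (forall b, b \in a1 :: s -> b \in cyc a /\ cyc b = cyc a) /\
    (lncomm (a1 ^ g) s = 1 \/ lncomm a1 [seq b ^ g | b <- s] = 1).

End Groups.

Definition left_Engel_set (G : groupType) : set G := [set x | left_Engel x].

Definition randomly_power_Engel_set (G : groupType) : set G :=
  [set a | randomly_power_Engel a].

Arguments fitting : clear implicits.
Arguments max_abelian_subgroups : clear implicits.
Arguments left_Engel_set : clear implicits.
Arguments randomly_power_Engel_set : clear implicits.

(* Main.v *)
Require Import Defs.
From mathcomp Require Import all_boot.
From mathcomp Require Import boolp classical_sets.

(** Left Engel elements are randomly power Engel, and elements of the Fitting
    subgroup are left Engel because a product of two nilpotent normal subgroups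
    is nilpotent ([nilpotent_product]).  What remains is that a randomly power
    Engel element [a] lies in a nilpotent normal subgroup.

    The maximal condition, given for abelian subgroups only, is first extended
    to nilpotent ones ([noetherian_nilpotent]).  If a group [L] has a maximal
    normal abelian subgroup [A] that is its own centraliser and whose
    [L]-invariant sections contain nontrivial elements centralised by [L], then
    [L] is built from the noetherian group [A] by finitely many extensions: for
    [B] inside [A] and [b] central modulo [B], the map [x |-> [b, x]] is a
    homomorphism from the centraliser of [B] to [B], and its kernel centralises
    one more element of [A] ([acc_central_factors]).  A nilpotent group has all
    these central elements.  So does the union of a chain of nilpotent groups
    [H_n] ([central_factor]): the central parts of the [H_n] on a section
    generate a group of class at most two, which is noetherian by the nilpotent
    case, so that they eventually form a descending chain in a noetherian
    group.  Central parts of exponent [p], or central parts of sections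
    without torsion, cannot descend to a trivial intersection
    ([descending_intersection]).

    Next, if a conjugate [x] of [a] normalises a nilpotent subgroup [N], then
    [N] and [x] generate a nilpotent group ([nilpotent_adjoin]).  On an abelian
    section [C / B] of [N] centralised by [N], and for generators [z], [y_1],
    ..., [y_k] of [cyc x], the commutator [[z ^ c, y_1, ..., y_k]] is, up to
    sign, the image of [c] under the product of the maps [z - 1], [y_1 - 1],
    ..., [y_k - 1]; when it is zero and [c] is not, some nontrivial element of
    [C / B] is fixed by one of these generators, hence by [x].

    Finally consider the maximal members of the family of nilpotent subgroups
    generated by conjugates of [a].  If there were two, choose [U] and [V]
    distinct such that the subgroup [I] generated by the conjugates of [a] in
    both is maximal.  The normaliser condition gives conjugates [u] in [U] and
    [v] in [V], outside [I], that normalise [I].  The randomly power Engel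
    condition, being symmetric in [u] and [v], gives for instance a sequence of
    commutators of [u] with generators of [cyc v] that ends in 1, hence a last
    term [z] outside the normaliser of [V]; then [v ^ z] normalises [V], so it
    belongs to [V] and to its conjugate by [z], which therefore have a larger
    intersection than [I] allows ([engel_sequence_contradiction]).  So the
    maximal member is unique, hence normal, and it contains [a]. *)

Set Implicit Arguments.
Unset Strict Implicit.
Unset Printing Implicit Defensive.

Local Open Scope classical_set_scope.
Local Open Scope group_scope.

Ltac gsimpl := rewrite /commg /conjg ?gnorm //.

(** * Subgroups, normality and commutators *)

Section Subgroups.
Variable G : groupType.
Implicit Types (a b c g h t x y : G) (A B C H K L N S T X : set G).

Lemma nsubset_witness S X : ~ (S `<=` X) -> exists x, S x /\ ~ X x.
Proof. by move=> /nonsubset[x [Sx nXx]]; exists x. Qed.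

Lemma subgroupP H :
  is_subgroup H <-> H 1 /\ forall x y, H x -> H y -> H (x * y^-1).
Proof.
split=> [[H1 HF]|[H1 HF]]; split.
- by move: H1; rewrite inE.
- by move=> x y Hx Hy; have := HF x y; rewrite !inE; apply.
- by rewrite inE.
- by move=> x y; rewrite !inE; apply: HF.
Qed.

Lemma sg1 H : is_subgroup H -> H 1.
Proof. by case/subgroupP. Qed.

Lemma sgF H x y : is_subgroup H -> H x -> H y -> H (x * y^-1).
Proof. by case/subgroupP=> _; apply. Qed.

Lemma sgV H x : is_subgroup H -> H x -> H x^-1.
Proof. by move=> sH Hx; rewrite -[_^-1]mul1g; apply: sgF => //; apply: sg1. Qed.

Lemma sgM H x y : is_subgroup H -> H x -> H y -> H (x * y).
Proof. by move=> sH Hx Hy; rewrite -[y]invgK; apply: sgF => //; apply: sgV. Qed.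

Lemma sgX H x n : is_subgroup H -> H x -> H (x ^+ n).
Proof.
move=> sH Hx; elim: n => [|n IH]; first exact: sg1.
by rewrite expgS; apply: sgM.
Qed.

Lemma sgJ H x y : is_subgroup H -> H x -> H y -> H (x ^ y).
Proof. by move=> sH Hx Hy; apply: sgM (sgV sH Hy) (sgM _ _ _). Qed.

Lemma sgR H x y : is_subgroup H -> H x -> H y -> H [~ x, y].
Proof. by move=> sH Hx Hy; apply: sgM (sgV sH Hx) (sgJ _ _ _). Qed.

Lemma sgMl H x y : is_subgroup H -> H x -> H (x * y) -> H y.
Proof. by move=> sH Hx Hxy; rewrite -(mulKg x y); apply: sgM => //;
  apply: sgV. Qed.

Lemma sgMr H x y : is_subgroup H -> H y -> H (x * y) -> H x.
Proof. by move=> sH Hy Hxy; rewrite -(mulgK y x); apply: sgF. Qed.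

Lemma sg_trivial : is_subgroup [set 1 : G].
Proof. by apply/subgroupP; split=> //= x y -> ->; rewrite gsimp. Qed.

Lemma sg_setT : is_subgroup [set: G].
Proof. exact/subgroupP. Qed.

Lemma sgI H K : is_subgroup H -> is_subgroup K -> is_subgroup (H `&` K).
Proof.
move=> sH sK; apply/subgroupP; split; first by split; apply: sg1.
by move=> x y [Hx Kx] [Hy Ky]; split; apply: sgF.
Qed.

Lemma sg_gen S : is_subgroup (gen S).
Proof.
apply/subgroupP; split=> [H [sH _]|x y Sx Sy H HS]; first exact: sg1.
by case: (HS) => sH _; apply: sgF => //; [apply: Sx|apply: Sy].
Qed.

Lemma sub_gen S : S `<=` gen S.
Proof. exact: sub_gen_smallest. Qed.

Lemma gen_min S H : is_subgroup H -> S `<=` H -> gen S `<=` H.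
Proof. exact: smallest_sub. Qed.

Lemma gen_mono S X : S `<=` X -> gen S `<=` gen X.
Proof. by move=> SX; apply: gen_min (sg_gen _) (subset_trans SX (@sub_gen _)).
  Qed.

Lemma cyc_refl x : cyc x x.
Proof. exact: sub_gen. Qed.

Lemma cyc_min x H : is_subgroup H -> H x -> cyc x `<=` H.
Proof. by move=> sH Hx; apply: gen_min => // y ->. Qed.

Lemma eq_cyc_in x y H : is_subgroup H -> cyc x = cyc y -> H x -> H y.
Proof. by move=> sH exy Hx; apply: (cyc_min sH Hx); rewrite exy;
  apply: cyc_refl. Qed.

Lemma cycP x y : cyc x y -> exists k, y = x ^+ k \/ y^-1 = x ^+ k.
Proof.
have comm i j : commute (x ^+ i) (x ^- j) by apply/commuteV/commuteX2.
suff: cyc x `<=` [set y | exists i j, y = x ^+ i * x ^- j].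
  move=> /[apply] -[i [j ->]]; case: (leqP j i) => [ji|/ltnW ij].
    by exists (i - j)%N; left; rewrite expgnFr.
  by exists (j - i)%N; right; rewrite invgM invgK expgnFr.
apply: cyc_min; last by exists 1%N, 0%N; rewrite invg1 mulg1.
apply/subgroupP; split; first by exists 0%N, 0%N; rewrite mulgV.
move=> _ _ [i [j ->]] [k [l ->]]; exists (i + l)%N, (j + k)%N.
rewrite invgM invgK (addnC j) !expgnDr invgM -!mulgA.
by rewrite [x ^- j * (x ^+ l * _)]mulgA -comm -!mulgA.
Qed.

(** [L] need not contain [N]: when both are subgroups, this is normality of [N]
    in the group that they generate. *)
Definition normal_in N L := forall x g, N x -> L g -> N (x ^ g).

Lemma normal_inI N K L :
  normal_in N L -> normal_in K L -> normal_in (N `&` K) L.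
Proof. by move=> nN nK x g [Nx Kx] Lg; split; [apply: nN|apply: nK]. Qed.

Lemma normal_sub N L K : K `<=` L -> normal_in N L -> normal_in N K.
Proof. by move=> KL nN x g Nx /KL; apply: nN. Qed.

Lemma normal_self L : is_subgroup L -> normal_in L L.
Proof. by move=> sL x g; apply: sgJ. Qed.

Lemma normal_trivial L : normal_in [set 1] L.
Proof. by move=> x g /= -> _; rewrite conj1g. Qed.

Lemma normal_R N L x g : is_subgroup N -> normal_in N L ->
  N x -> L g -> N [~ x, g].
Proof. by move=> sN nN Nx Lg; apply: (sgM sN (sgV sN Nx)); apply: nN. Qed.

Lemma normal_Rl N L x g : is_subgroup N -> normal_in N L ->
  N x -> L g -> N [~ g, x].
Proof. by move=> sN nN Nx Lg; rewrite -invgR; apply: (sgV sN);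
  apply: (@normal_R N L). Qed.

Lemma normal_gen S L : is_subgroup L ->
  (forall s g, S s -> L g -> gen S (s ^ g)) -> normal_in (gen S) L.
Proof.
move=> sL nS x g Sx Lg.
suff: gen S `<=` [set x | gen S (x ^ g)] by apply.
apply: gen_min; last by move=> s Ss; apply: nS.
apply/subgroupP; split=> [|y z] /=; first by rewrite conj1g;
  exact: sg1 (sg_gen S).
by rewrite conjMg conjVg; apply: (sgF (sg_gen S)).
Qed.

(** Modulo [B], this is the centraliser of [c] in [T]. *)
Lemma sg_comm_r B T c : is_subgroup B -> is_subgroup T -> normal_in B T ->
  is_subgroup [set t | T t /\ B [~ c, t]].
Proof.
move=> sB sT nB; apply/subgroupP; split=> [|x y [Tx Bx] [Ty By]].
  by split; [apply: sg1|rewrite commg1; apply: sg1].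
split; first exact: sgF.
have ->: [~ c, x * y^-1] = [~ c, y]^-1 ^ y^-1 * [~ c, x] ^ y^-1.
  by gsimpl.
by apply: sgM => //; apply: nB; rewrite ?invgK //; apply: sgV.
Qed.

Lemma sg_comm_l B T t : is_subgroup B -> is_subgroup T -> normal_in B T ->
  is_subgroup [set c | T c /\ B [~ c, t]].
Proof.
move=> sB sT nB.
have ->: [set c | T c /\ B [~ c, t]] = [set c | T c /\ B [~ t, c]].
  by apply/seteqP; split=> c [Tc Bc]; split=> //; rewrite -invgR; apply: sgV.
exact: sg_comm_r.
Qed.

Lemma comm_gen B T S X : is_subgroup B -> is_subgroup T -> normal_in B T ->
  S `<=` T -> X `<=` T -> (forall s x, S s -> X x -> B [~ s, x]) ->
  forall s x, gen S s -> gen X x -> B [~ s, x].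
Proof.
move=> sB sT nB ST XT BSX s x Ss Xx.
have BsX y : X y -> B [~ s, y].
  move=> Xy; suff: gen S `<=` [set c | T c /\ B [~ c, y]] by case/(_ _ Ss).
  apply: gen_min; first exact: sg_comm_l.
  by move=> z Sz; split; [apply: ST|apply: BSX].
suff: gen X `<=` [set t | T t /\ B [~ s, t]] by case/(_ _ Xx).
apply: gen_min; first exact: sg_comm_r.
by move=> z Sz; split; [apply: XT|apply: BsX].
Qed.

(** The centraliser of [B] in [L]. *)
Definition cent L B := [set x | L x /\ forall b, B b -> commute b x].

Lemma sg_cent L B : is_subgroup L -> is_subgroup (cent L B).
Proof.
move=> sL; apply/subgroupP; split=> [|x y [Lx cx] [Ly cy]].
  by split=> [|b _]; [apply: sg1|apply: commute1].
split=> [|b Bb]; first exact: sgF.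
by apply: commuteM (cx b Bb) _; apply/commuteV/cy.
Qed.

Lemma cent_gen L S x : L x -> (forall s, S s -> commute s x) ->
  cent L (gen S) x.
Proof.
move=> Lx cS; split=> // b Sb; apply/commute_sym.
have sC : is_subgroup (cent [set: G] [set x]) by apply/sg_cent/sg_setT.
suff [_ /(_ x erefl)] : cent [set: G] [set x] b by [].
by apply: gen_min Sb => // s Ss; split=> // _ ->; apply/commute_sym/cS.
Qed.

Lemma normal_cent L B : is_subgroup L -> normal_in B L ->
  normal_in (cent L B) L.
Proof.
move=> sL nB x g [Lx cx] Lg; split=> [|b Bb]; first exact: sgJ.
have := cx _ (nB b g^-1 Bb (sgV sL Lg)) => cb.
by rewrite -(conjgKV g b) /commute -!conjMg cb.
Qed.

Definition normaliser N := [set t | forall y, N y -> N (y ^ t) /\ N (y ^ t^-1)].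

Lemma sg_normaliser N : is_subgroup (normaliser N).
Proof.
apply/subgroupP; split=> [y Ny|s t nNs nNt y Ny]; first by rewrite invg1 conjg1.
have [[Ns Ns'] [Nt Nt']] := (nNs y Ny, nNt y Ny).
have [[_ Nts] [_ Nst]] := (nNs _ Nt, nNt _ Ns).
by rewrite invgF !conjgM; split=> //; have [] := nNs _ Nt.
Qed.

Lemma sub_normaliser N : is_subgroup N -> N `<=` normaliser N.
Proof. by move=> sN x Nx y Ny; split; apply: sgJ => //; apply: sgV. Qed.

Lemma normal_normaliser N L : L `<=` normaliser N -> normal_in N L.
Proof. by move=> LN x g Nx /LN/(_ x Nx)[]. Qed.

Lemma normaliser_eqcyc N x y : cyc x = cyc y -> normaliser N x ->
  normaliser N y.
Proof. by apply: eq_cyc_in; apply: sg_normaliser. Qed.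

Lemma abelianP H : is_abelian H <-> forall x y, H x -> H y -> commute x y.
Proof.
by split=> aH x y; [move=> Hx Hy; apply: aH; rewrite inE|
  rewrite !inE; apply: aH].
Qed.

Lemma abelian_gen S : (forall x y, S x -> S y -> commute x y) ->
  is_abelian (gen S).
Proof.
move=> cS; apply/abelianP=> x y Sx Sy.
suff [_ /(_ x Sx)] : cent [set: G] (gen S) y by [].
apply: gen_min Sy; first exact/sg_cent/sg_setT.
by move=> z Sz; apply: cent_gen => // s Ss; apply: cS.
Qed.

End Subgroups.

(** * Nilpotent actions *)

Section Nilpotency.
Variable G : groupType.
Implicit Types (a b c g h t x y : G) (A B C H K L M N S T X Z : set G).

(** [T] acts nilpotently on [Z]: some descending series from [Z] to 1 has all
    its factors centralised by [T].  Applied to [T] itself it is nilpotency, in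
    a form that allows induction along the series. *)
Inductive hypercentral T : set G -> Prop :=
| hypercentral1 : hypercentral T [set 1]
| hypercentralS B C : hypercentral T B -> is_subgroup C ->
    (forall c t, C c -> T t -> B [~ c, t]) -> hypercentral T C.

Lemma sg_hypercentral T Z : hypercentral T Z -> is_subgroup Z.
Proof. by case=> *; first exact: sg_trivial. Qed.

Lemma hypercentral_sub T H Z : is_subgroup H -> H `<=` T ->
  hypercentral T Z -> hypercentral H (Z `&` H).
Proof.
move=> sH HT; elim=> [|B C _ IH sC BC].
  have -> : [set 1] `&` H = [set 1 : G]; last exact: hypercentral1.
  by apply/seteqP; split=> [x []|x /= ->] //; split=> //; apply: sg1.
apply: hypercentralS IH (sgI sC sH) _ => c t [Cc Hc] Ht.
by split; [apply: BC => //; apply: HT|apply: sgR].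
Qed.

Lemma hypercentral_iter T n X : is_subgroup X ->
  iter n (fun K => comm_subgroup K T) X = [set 1] -> hypercentral T X.
Proof.
elim: n X => [|n IH] X sX /=; first by move=> ->; apply: hypercentral1.
rewrite -/(iter n.+1 (fun K => comm_subgroup K T) X) iterSr => XE.
apply: hypercentralS (IH _ (sg_gen _) XE) sX _ => c t Xc Tt.
by apply: sub_gen; exists c, t; rewrite !inE.
Qed.

Lemma iter_hypercentral T Z X : hypercentral T Z -> is_subgroup X -> X `<=` Z ->
  exists n, iter n (fun K => comm_subgroup K T) X = [set 1].
Proof.
move=> hZ; elim: hZ X => [|B C hB IH sC BC] X sX XC.
  by exists 0%N; apply/seteqP; split=> // _ ->; apply: sg1.
have [|n En] := IH (comm_subgroup X T) (sg_gen _).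
  apply: (gen_min (sg_hypercentral hB)) => z [x [t []]];
    rewrite !inE => Xx Tt ->.
  by apply: BC => //; apply: XC.
by exists n.+1; rewrite iterSr.
Qed.

Lemma nilpotentP T : is_subgroup T -> is_nilpotent T <-> hypercentral T T.
Proof.
move=> sT; split=> [[n Tn]|hT]; first exact: hypercentral_iter Tn.
by have [n Tn] := iter_hypercentral hT sT (@subset_refl _ T); exists n.
Qed.

Lemma nilpotent_sub H T : is_subgroup H -> is_subgroup T -> H `<=` T ->
  is_nilpotent T -> is_nilpotent H.
Proof.
move=> sH sT HT /(nilpotentP sT) hT; apply/(nilpotentP sH).
by have := hypercentral_sub sH HT hT; rewrite (setIidr HT).
Qed.

(** The first term of the series to escape [B] supplies the witness. *)
Lemma hypercentral_witness T Z A B : is_subgroup B -> is_subgroup A ->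
  normal_in A T -> hypercentral T Z -> ~ (A `&` Z `<=` B) ->
  exists b, [/\ A b, ~ B b & forall t, T t -> B [~ b, t]].
Proof.
move=> sB sA nA; elim=> [|C D _ IH sD CD] nAB.
  by case: nAB => x [_ /= ->]; apply: sg1.
have [AC|/IH //] := pselect (A `&` C `<=` B).
have [b [[Ab Db] nBb]] := nsubset_witness nAB.
exists b; split=> // t Tt; apply: AC; split; first exact: (@normal_R _ A T).
exact: CD.
Qed.

(** The normaliser condition: all terms of the series below the first one to
    escape [M] are in [M], so that the commutators with [M] of an element of
    that first term are in [M]. *)
Lemma nilpotent_normaliser M U : is_subgroup M -> is_subgroup U ->
  is_nilpotent U -> M `<=` U -> ~ (U `<=` M) ->
  exists y, [/\ U y, ~ M y & normaliser M y].
Proof.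
move=> sM sU /(nilpotentP sU) nU MU.
suff main Z : hypercentral U Z -> ~ (U `&` Z `<=` M) ->
    exists y, [/\ U y, ~ M y & normaliser M y].
  by move=> nUM; apply: (main U) => //; rewrite setIid.
elim=> [|C D hC IH sD CD] nDM; first by case: nDM => x [_ /= ->]; apply: sg1.
have [CM|/IH //] := pselect (U `&` C `<=` M).
have [y [[Uy Dy] nMy]] := nsubset_witness nDM.
suff conjM z : U z -> D z -> forall m, M m -> M (m ^ z).
  by exists y; split=> // m Mm; split; apply: conjM => //; apply: sgV.
move=> Uz Dz m Mm; have -> : m ^ z = m * [~ z, m]^-1 by gsimpl.
by apply: (sgF sM Mm); apply: CM; split; [apply: sgR => //|apply: CD => //];
  apply: MU.
Qed.

End Nilpotency.

(** * The maximal condition *)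

Section Noetherian.
Variable G : groupType.
Implicit Types (a b c g h t x y : G) (A B C H K L M N S T X Y Z : set G).
Implicit Types (F P : set G -> Prop).

(** The maximal condition for a family [F] of subgroups, as the existence of
    maximal members in nonempty subfamilies. *)
Definition noetherian F :=
  forall P, (forall X, P X -> F X) -> (exists X, P X) ->
  exists X, P X /\ forall Y, P Y -> X `<=` Y -> Y `<=` X.

Lemma noetherian_of_chains F :
  (forall X_ : nat -> set G, (forall n, F (X_ n)) ->
     (forall n, X_ n `<=` X_ n.+1) ->
     exists m, forall n, (m <= n)%N -> X_ n = X_ m) ->
  noetherian F.
Proof.
move=> chF P PF [X0 PX0]; apply: contrapT => noX.
have /choice[f fP] : forall X, exists Y, P X -> [/\ P Y, X `<=` Y & ~ Y `<=` X].
  move=> X; have [[Y]|noY] :=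
    pselect (exists Y, [/\ P Y, X `<=` Y & ~ Y `<=` X]).
    by exists Y.
  exists X => PX; exfalso; apply: noX; exists X; split=> // Y PY XY;
    apply: contrapT => nYX.
  by apply: noY; exists Y.
have PX n : P (iter n f X0) by elim: n => [|n IH] //=; have [] := fP _ IH.
have [||m Em] := chF (fun n => iter n f X0); first by move=> n; apply/PF/PX.
  by move=> n; have [] := fP _ (PX n).
have [_ _] := fP _ (PX m); rewrite -/(iter m.+1 f X0) (Em m.+1) //; exact.
Qed.

Lemma noetherian_sub F F' : (forall X, F X -> F' X) -> noetherian F' ->
  noetherian F.
Proof. by move=> FF' nF P PF; apply: nF => X /PF/FF'. Qed.

Lemma noetherian_chain F (X_ : nat -> set G) : noetherian F ->
  (forall n, F (X_ n)) -> (forall n, X_ n `<=` X_ n.+1) ->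
  exists m, forall n, X_ n `<=` X_ m.
Proof.
move=> nF FX mX.
have mon i j : (i <= j)%N -> X_ i `<=` X_ j.
  move=> ij; rewrite -(subnKC ij); elim: (j - i)%N => [|k IH];
    first by rewrite addn0.
  by rewrite addnS; apply: subset_trans IH (mX _).
have [||_ [[m ->] maxm]] := nF (fun X => exists n, X = X_ n).
- by move=> _ [n ->].
- by exists (X_ 0), 0%N.
exists m => n; have [nm|/ltnW mn] := leqP n m; first exact: mon.
by apply: maxm (mon _ _ mn); exists n.
Qed.

Definition acc L := noetherian (fun X => is_subgroup X /\ X `<=` L).

Lemma acc_sub K L : K `<=` L -> acc L -> acc K.
Proof.
by move=> KL; apply: noetherian_sub => X [sX XK]; split=> //;
  apply: subset_trans KL.
Qed.

(** The ascending chain condition for [K], from the same condition for the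
    image of [K] under a homomorphism and for its kernel: maximise the image
    first and the intersection with the kernel next. *)
Lemma acc_extension K (phi : G -> G) B : is_subgroup K ->
  (forall x y, K x -> K y -> phi (x * y) = phi x * phi y) ->
  (forall x, K x -> B (phi x)) ->
  acc B -> acc [set x | K x /\ phi x = 1] -> acc K.
Proof.
move=> sK phiM phiB accB accker P PF [X0 PX0].
have phi1 : phi 1 = 1.
  by apply: (mulgI (phi 1)); rewrite -phiM ?mulg1 //; apply: sg1.
have phiV x : K x -> phi x^-1 = (phi x)^-1.
  move=> Kx; apply/esym/mulg1_eq; rewrite -phiM ?mulgV //; exact: sgV.
pose im X := phi @` X.
have [||_ [[X [-> PX]] maxX]] := accB (fun Y => exists X, Y = im X /\ P X).
- move=> _ [X [-> /PF[sX XK]]]; split.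
    apply/subgroupP; split; first by exists 1; [apply: sg1|].
    move=> _ _ [x Xx <-] [y Xy <-]; exists (x * y^-1); first exact: sgF.
    by rewrite phiM ?phiV //; [apply: XK|apply: XK|apply: XK; apply: sgV].
  by move=> _ [x Xx <-]; apply/phiB/XK.
- by exists (im X0), X0.
pose ker := [set x | K x /\ phi x = 1].
have sker : is_subgroup ker.
  apply/subgroupP; split=> [|x y [Kx x1] [Ky y1]]; first by split=> //;
    apply: sg1.
  split; first exact: sgF.
  by rewrite phiM ?phiV ?x1 ?y1 ?gsimp //; apply: sgV.
have [||_ [[Y [-> [PY XY]]] maxY]] :=
  accker (fun Z => exists Y, Z = Y `&` ker /\ P Y /\ X `<=` Y).
- move=> _ [Y [-> [/PF[sY YK] XY]]]; split; first exact: sgI.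
  by move=> x [].
- by exists (X `&` ker), X; split=> //; split.
exists Y; split=> // Z PZ YZ z Zz.
have XZ := subset_trans XY YZ.
have [sZ ZK] := PF _ PZ; have [sY YK] := PF _ PY.
have [x Xx xz] : im X (phi z).
  by apply: (maxX (im Z)); [exists Z|
    move=> _ [x Xx <-]; exists x => //; apply: XZ|exists z].
have Zzx : Z (z * x^-1) by apply: (sgF sZ) => //; apply: XZ.
have [Yzx _] : (Y `&` ker) (z * x^-1).
  apply: (maxY (Z `&` ker)).
  - by exists Z.
  - by move=> y [Yy ky]; split=> //; apply: YZ.
  - split=> //; split; first exact: ZK.
    have [Kz Kx] : K z /\ K x by split; [apply: ZK|apply: ZK; apply: XZ].
    by rewrite phiM ?phiV ?xz ?mulgV //; apply: sgV.
by rewrite -(mulgVK x z); apply: (sgM sY) => //; apply: XY.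
Qed.

End Noetherian.

(** * Central factors and the maximal condition *)

Section CentralFactors.
Variable G : groupType.
Implicit Types (a b c g h t x y : G) (A B C H K L M N S T X Y Z : set G).

(** The part of nilpotency of [L] that passes to unions of chains: every
  nontrivial
    normal section [A / B] with [B] central in [A] meets the centre of [L / B].
      It is
    needed for [A] abelian, and for [A] the centraliser of an abelian [B]. *)
Definition has_central_factors L :=
  forall A B, is_subgroup A -> is_subgroup B -> A `<=` L -> B `<=` A ->
  normal_in A L -> normal_in B L -> (forall a b, A a -> B b -> commute b a) ->
  ~ (A `<=` B) -> exists b, [/\ A b, ~ B b & forall t, L t -> B [~ b, t]].

Lemma nilpotent_central_factors L : is_subgroup L -> is_nilpotent L ->
  has_central_factors L.
Proof.
move=> sL /(nilpotentP sL) hL A B sA sB AL BA nA nB _ AB.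
by apply: hypercentral_witness hL _ => //; rewrite (setIidl AL).
Qed.

Definition adjoin B b := gen (B `|` [set b]).

Lemma sg_adjoin B b : is_subgroup (adjoin B b).
Proof. exact: sg_gen. Qed.

Lemma adjoin_sub B b : B `<=` adjoin B b.
Proof. by move=> x Bx; apply: sub_gen; left. Qed.

Lemma adjoin_mem B b : adjoin B b b.
Proof. by apply: sub_gen; right. Qed.

Lemma adjoin_min B b H : is_subgroup H -> B `<=` H -> H b -> adjoin B b `<=` H.
Proof. by move=> sH BH Hb; apply: gen_min => // x [/BH|->]. Qed.

Lemma normal_adjoin B b L : is_subgroup L -> normal_in B L -> L b ->
  (forall t, L t -> B [~ b, t]) -> normal_in (adjoin B b) L.
Proof.
move=> sL nB Lb Bb; apply: normal_gen => // s g [Bs|->] Lg.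
  by apply: adjoin_sub; apply: nB.
rewrite -/(adjoin B b); have -> : b ^ g = b * [~ b, g] by gsimpl.
by apply: (sgM (sg_adjoin B b) (@adjoin_mem B b)); apply: adjoin_sub; apply: Bb.
Qed.

Hypothesis maxG : noetherian (fun X : set G => is_subgroup X /\ is_abelian X).

Lemma acc_abelian A : is_subgroup A -> is_abelian A -> acc A.
Proof.
move=> sA /abelianP aA; apply: noetherian_sub maxG => X [sX XA]; split=> //.
by apply/abelianP=> x y /XA Ax /XA Ay; apply: aA.
Qed.

(** A maximal normal abelian subgroup [A] is its own centraliser, and a maximal
    [B] inside [A] with a non-noetherian centraliser is refuted by passing from
    [B] to [adjoin B b], with [b] central modulo [B]. *)
Lemma acc_central_factors L : is_subgroup L -> has_central_factors L -> acc L.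
Proof.
move=> sL cfL.
pose P X := [/\ is_subgroup X, X `<=` L, is_abelian X & normal_in X L].
have [||A [[sA AL aA nA] maxA]] := maxG (P := P); first by move=> X [].
  exists [set 1]; split; [exact: sg_trivial|by move=> _ ->; exact: sg1| |
    exact: normal_trivial].
  by apply/abelianP=> _ _ -> ->.
have /abelianP cA := aA.
have CA : cent L A `<=` A.
  apply: contrapT => nCA.
  have [|||||b [[Lb cb] nAb Ab]] := cfL (cent L A) A _ sA _ _ _ nA _ nCA.
  - exact: sg_cent.
  - by move=> x [].
  - by move=> x Ax; split=> [|y Ay]; [apply: AL|apply: cA].
  - exact: normal_cent.
  - by move=> x y [_ cx] /cx.
  apply: nAb; apply: (maxA (adjoin A b) _ _ _ (@adjoin_mem A b));
    last exact: adjoin_sub.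
  split; [exact: sg_adjoin|exact: adjoin_min| |exact: normal_adjoin].
  apply: abelian_gen => x y [Ax|->] [Ay|->] //; first exact: cA;
    first exact: cb.
  exact/commute_sym/cb.
apply: contrapT => naccL.
pose Q B := [/\ is_subgroup B, B `<=` A, normal_in B L & ~ acc (cent L B)].
have [||B [[sB BA nB naccB] maxB]] := @acc_abelian A sA aA Q.
- by move=> X [].
- exists [set 1]; split; [exact: sg_trivial|by move=> _ ->; exact: sg1|
  exact: normal_trivial|].
  move=> accC; apply: naccL; apply: (@acc_sub _ _ _ _ accC) => x Lx;
    split=> // _ ->.
  exact/commute_sym/commute1.
have nAB : ~ (A `<=` B).
  move=> AB; apply: naccB; apply: (@acc_sub _ _ _ _ (@acc_abelian A sA aA)) =>
    x [Lx cx].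
  by apply: CA; split=> // y /AB; apply: cx.
have [|b [Ab nBb Bb]] := cfL A B sA sB AL BA nA nB _ nAB.
  by move=> a b Aa /BA Ab; apply: cA.
have LB : B `<=` L by apply: subset_trans AL.
apply: nBb; apply: (maxB (adjoin B b) _ _ _ (@adjoin_mem B b));
  last exact: adjoin_sub.
split; [exact: sg_adjoin|exact: adjoin_min|
  by apply: normal_adjoin => //; apply: AL|].
move=> accB'; apply: naccB.
apply: (@acc_extension _ _ (fun x => [~ b, x]) B).
- exact: sg_cent.
- move=> x y [Lx cx] [Ly cy].
  have -> : [~ b, x * y] = [~ b, y] * [~ b, x] ^ y by gsimpl.
  have /conjg_fixP -> : [~ [~ b, x], y] == 1 by apply/commgP/cy/Bb.
  by apply: cA; apply/BA/Bb.
- by move=> x [Lx _]; apply: Bb.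
- exact: (@acc_sub _ _ _ BA (@acc_abelian A sA aA)).
apply: (@acc_sub _ _ _ _ accB') => x [[Lx cx] bx];
  apply: cent_gen => // s [/cx //|->].
by apply/commgP/eqP.
Qed.

Lemma acc_nilpotent L : is_subgroup L -> is_nilpotent L -> acc L.
Proof.
by move=> sL nL; apply/acc_central_factors/nilpotent_central_factors.
Qed.

End CentralFactors.

(** * Torsion in central factors *)

Section Torsion.
Variable G : groupType.
Implicit Types (a b c g h t x y : G) (A B C H K L M N S T X Y Z : set G).

(** Modulo [M], the commutator [[x, h]] commutes with [x], so that
    [[x ^+ n, h]] is its power. *)
Lemma comm_expg H M x h n : is_subgroup H -> is_subgroup M -> normal_in M H ->
  H x -> H h -> M [~ [~ x, h], x] -> M [~ x ^+ n, h] <-> M ([~ x, h] ^+ n).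
Proof.
move=> sH sM nM Hx Hh; set c := [~ x, h] => Mcx.
have Hc : H c by apply: sgR.
suff Mn : M ((c ^+ n)^-1 * [~ x ^+ n, h]).
  split=> Mx; last by have := sgM sM Mx Mn; rewrite mulVKg.
  by rewrite -[_ ^+ n]invgK; apply: sgV sM (sgMr sM Mx Mn).
elim: n => [|n IH]; first by rewrite expg0 comm1g !gsimp; apply: sg1.
have -> : [~ x ^+ n.+1, h] = c * [~ c, x ^+ n] * [~ x ^+ n, h].
  by rewrite expgS /c; gsimpl.
have -> : (c ^+ n.+1)^-1 * (c * [~ c, x ^+ n] * [~ x ^+ n, h]) =
    [~ c, x ^+ n] ^ (c ^+ n) * ((c ^+ n)^-1 * [~ x ^+ n, h]).
  by rewrite expgS; move: [~ c, x ^+ n] [~ x ^+ n, h] => u v; gsimpl.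
apply: sgM IH => //; apply: (nM); last exact: sgX.
suff: cyc x `<=` [set t | H t /\ M [~ c, t]].
  by move=> /(_ (x ^+ n)) [] //; apply: (@sgX _ (cyc x));
    [exact: sg_gen|exact: cyc_refl].
by apply: cyc_min; [exact: (sg_comm_r c sM sH nM)|split].
Qed.

Section UpperCentral.
Variables A B H : set G.
Hypotheses (sA : is_subgroup A) (sB : is_subgroup B) (sH : is_subgroup H).
Hypotheses (AH : A `<=` H) (BA : B `<=` A).
Hypotheses (nA : normal_in A H) (nB : normal_in B H).

(** The upper central series of [H], taken inside [A] and above [B]. *)
Fixpoint upper_central n : set G :=
  if n is m.+1 then [set x | A x /\ forall h, H h -> upper_central m [~ x, h]]
  else B.

Lemma upper_central_normal n :
  [/\ is_subgroup (upper_central n), upper_central n `<=` A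
    & normal_in (upper_central n) H].
Proof.
elim: n => [|n [sZ ZA nZ]] //=; split; last 1 first.
- move=> x g [Ax Zx] Hg; split=> [|h Hh]; first exact: nA.
  rewrite -(conjgKV g h) -conjRg; apply: nZ => //; apply: Zx.
  by apply: sgJ => //; apply: sgV.
- apply/subgroupP; split=> [|x y [Ax Zx] [Ay Zy]].
    by split=> [|h _]; [apply: sg1|rewrite comm1g; apply: sg1].
  split=> [|h Hh]; first exact: sgF.
  by case: (@sgF _ _ x y (sg_comm_l h sZ sH nZ)) => //; split; auto.
- by move=> x [].
Qed.

Lemma upper_centralS n : upper_central n `<=` upper_central n.+1.
Proof.
have [sZ ZA nZ] := upper_central_normal n.
by move=> x Zx; split=> [|h Hh]; [apply: ZA|apply: (normal_R sZ nZ)].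
Qed.

Lemma upper_central_mono i j : (i <= j)%N ->
  upper_central i `<=` upper_central j.
Proof.
move=> ij; rewrite -(subnKC ij); elim: (j - i)%N => [|k IH].
  by rewrite addn0.
by rewrite addnS; apply: subset_trans IH (@upper_centralS _).
Qed.

Lemma upper_central_exhausts Z : hypercentral H Z ->
  exists n, A `&` Z `<=` upper_central n.
Proof.
elim=> [|C D _ [n IH] _ CD]; first by exists 0%N => x [_ /= ->]; apply: sg1.
exists n.+1 => x [Ax Dx]; split=> // h Hh; apply: IH; split; last exact: CD.
exact: (normal_R sA nA).
Qed.

(** If the centre of [H] on [A / B] is without [p]-torsion, then so are all
    upper central factors: commutations with the elements of [H] map each factor
    homomorphically, and jointly injectively, into the one below. *)
Lemma upper_central_torsion p n x :
  (forall y, upper_central 1 y -> B (y ^+ p) -> B y) -> is_nilpotent H ->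
  A x -> upper_central n (x ^+ p) -> upper_central n x.
Proof.
move=> tf /(nilpotentP sH)/upper_central_exhausts[m].
rewrite (setIidl AH) => AZ Ax.
have factor i : forall y, upper_central i.+1 y -> upper_central i (y ^+ p) ->
    upper_central i y.
  elim: i => [|i IH] y Zy Zyp; first exact: tf.
  have [Ay Zyh] := Zy; split=> // h Hh; apply: IH; first exact: Zyh.
  have [sZ ZA nZ] := upper_central_normal i.
  apply: (iffLR (comm_expg p sH sZ nZ (AH Ay) Hh _)).
    by have [_] := Zyh h Hh; apply; apply: AH.
  by have [_] := Zyp; apply.
move=> Zxp; have: upper_central (n + m) x.
  by apply: (@upper_central_mono m); [apply: leq_addl|apply: AZ].
elim: m {AZ} => [|m IH]; first by rewrite addn0.
rewrite addnS => Zx; apply/IH/factor => //.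
by apply: (@upper_central_mono n) => //; apply: leq_addr.
Qed.

End UpperCentral.
End Torsion.

(** * Unions of chains of nilpotent subgroups *)

Section Chains.
Variable G : groupType.
Implicit Types (a b c g h t x y : G) (A B C H K L M N S T X Y Z : set G).

(** The last hypothesis says that an element of [J_ m] outside [J_ n] is, modulo
    [B], independent of [J_ n].  Were the intersection trivial modulo [B], a
    maximal subgroup [E] of [K] among those that meet some [J_ n] trivially
    could be enlarged: an element [x] of [J_ n] that has left [J_ m] is
    independent of [J_ m], so [E] and [x] generate a group that meets [J_ m]
    trivially. *)
Lemma descending_intersection K B (J_ : nat -> set G) :
  acc K -> is_subgroup K -> is_subgroup B ->
  (forall x y, K x -> K y -> B [~ x, y]) ->
  (forall n, is_subgroup (J_ n)) -> (forall n, J_ n `<=` K) ->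
  (forall m n, (m <= n)%N -> J_ n `<=` J_ m) ->
  (forall n, B `&` K `<=` J_ n) ->
  (forall n, ~ (J_ n `<=` B)) ->
  (forall m n k x, J_ m x -> ~ J_ n x -> (0 < k)%N -> J_ n (x ^+ k) ->
    B (x ^+ k)) ->
  exists x, ~ B x /\ forall n, J_ n x.
Proof.
move=> accK sK sB KB sJ JK dJ BJ nJB tf; apply: contrapT => no.
pose P E := [/\ is_subgroup E, E `<=` K, B `&` K `<=` E & exists n,
  E `&` J_ n `<=` B].
have [||E [[sE EK BE [n En]] maxE]] := accK P; first by move=> X [].
  exists (B `&` K); split; [exact: sgI|by move=> x []|by []|].
  by exists 0%N => x [[]].
have [x [Jx nBx]] := nsubset_witness (nJB n).
have Kx : K x by apply: JK Jx.
have [m nJm] : exists m, ~ J_ m x.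
  apply: contrapT => nom; apply: no; exists x; split=> // m.
  by apply: contrapT => nJm; apply: nom; exists m.
have nm : (n <= m)%N by apply: contrapT => /negP;
  rewrite -ltnNge => /ltnW /dJ/(_ x Jx).
have cycK : cyc x `<=` K by apply: cyc_min.
have sC := sg_gen [set x] : is_subgroup (cyc x).
pose E' := [set y | K y /\ exists c, cyc x c /\ E (y * c)].
have xE' : E' x.
  split=> //; exists x^-1; split; first by apply: (sgV sC); exact: cyc_refl.
  by rewrite mulgV; apply: sg1.
have sE' : is_subgroup E'.
  apply/subgroupP; split=> [|y z [Ky [c [Cc Ec]]] [Kz [d [Cd Ed]]]].
    by split; [apply: sg1|exists 1; rewrite mulg1; split; [exact: (sg1 sC)|
      exact: sg1]].
  split; first exact: sgF.
  exists (c * d^-1); split; first exact: (sgF sC).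
  have Kw : K (c * d^-1) by apply: cycK; apply: (sgF sC).
  have -> : y * z^-1 * (c * d^-1) = y * c * (z * d)^-1 * [~ z^-1, c * d^-1].
    by gsimpl.
  apply: (sgM sE); first exact: sgF.
  by apply: BE; split; [apply: KB|apply: sgR] => //; apply: sgV.
have E'E : E' `<=` E.
  apply: maxE; last by move=> y Ey; split;
    [apply: EK|exists 1; rewrite mulg1; split=> //; exact: (sg1 sC)].
  split=> //; first by move=> y [].
    move=> y BKy; split; first by case: BKy.
    by exists 1; rewrite mulg1; split; [exact: (sg1 sC)|apply: BE].
  exists m => y [[Ky [c [Cc Ec]]] Jy].
  have Jnc : J_ n c by apply: cyc_min Cc => //; apply: sJ.
  have Byc : B (y * c) by apply: En; split=> //; apply: (sgM (sJ n)) => //;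
    apply: (dJ _ _ nm).
  have Jmc : J_ m c.
    apply: (sgMl (sJ m) Jy); apply: BJ; split=> //; exact: EK.
  suff Bc : B c by apply: sgMr sB Bc Byc.
  have tfk k : J_ m (x ^+ k) -> B (x ^+ k).
    by case: k => [|k] Jk; [apply: sg1|apply: (tf n m)].
  have [k [ck|ck]] := cycP Cc; first by rewrite ck; apply: tfk; rewrite -ck.
  by rewrite -[c]invgK; apply: sgV => //; rewrite ck; apply: tfk; rewrite -ck;
    apply: sgV.
by apply: nBx; apply: En; split=> //; apply: E'E.
Qed.

(** Powers are multiplicative modulo [B]. *)
Lemma sg_exponent_mod K B p : is_subgroup K -> is_subgroup B ->
  (forall x y, K x -> K y -> B [~ x, y]) ->
  (forall x b, K x -> B b -> commute b x) ->
  is_subgroup [set x | K x /\ B (x ^+ p)].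
Proof.
move=> sK sB KB cB.
have powM x y n : K x -> K y ->
  exists b, B b /\ (x * y) ^+ n = x ^+ n * y ^+ n * b.
  move=> Kx Ky; elim: n => [|n [b [Bb IH]]].
    by exists 1; rewrite !gsimp; split=> //; apply: sg1.
  exists ([~ y ^+ n, x] * b); split.
    by apply: sgM => //; apply: KB => //; apply: sgX.
  have BR : B [~ y ^+ n, x] by apply: KB => //; apply: sgX.
  have cby : b * (x * y) = x * y * b by apply: cB => //; apply: sgM.
  have cRy : [~ y ^+ n, x] * y = y * [~ y ^+ n, x] by apply: cB.
  rewrite expgSr IH -(mulgA _ b) cby !expgSr.
  have wx := commgC (y ^+ n) x; move: (y ^+ n) {BR IH} cRy wx => w.
  move: [~ w, x] => c cy wx.
  by rewrite !mulgA -(mulgA (x ^+ n)) wx !mulgA -(mulgA _ c y) cy !mulgA.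
apply/subgroupP; split=> [|x y [Kx Bx] [Ky By]].
  by rewrite /= expg1n; split; apply: sg1.
split; first exact: sgF.
rewrite /=; have [b [Bb ->]] := powM x y^-1 p Kx (sgV sK Ky).
by rewrite expVgn; apply: sgM => //; apply: sgF.
Qed.

Hypothesis maxG : noetherian (fun X : set G => is_subgroup X /\ is_abelian X).

Variable H_ : nat -> set G.
Hypothesis sH : forall n, is_subgroup (H_ n).
Hypothesis nilH : forall n, is_nilpotent (H_ n).
Hypothesis HS : forall n, H_ n `<=` H_ n.+1.

Lemma chain_mono m n : (m <= n)%N -> H_ m `<=` H_ n.
Proof.
move=> mn; rewrite -(subnKC mn); elim: (n - m)%N => [|k IH];
  first by rewrite addn0.
by rewrite addnS; apply: subset_trans IH (@HS _).
Qed.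

Let L := \bigcup_n H_ n.

Lemma sg_union : is_subgroup L.
Proof.
apply/subgroupP; split; first by exists 0%N => //; apply: sg1.
move=> x y [m _ Hx] [n _ Hy]; exists (maxn m n) => //.
by apply: sgF => //; [apply: (chain_mono (leq_maxl m n))|
  apply: (chain_mono (leq_maxr m n))].
Qed.

Lemma union_sub n : H_ n `<=` L.
Proof. by move=> x Hx; exists n. Qed.

Section Factor.
Variables A B : set G.
Hypotheses (sA : is_subgroup A) (sB : is_subgroup B).
Hypotheses (AL : A `<=` L) (BA : B `<=` A).
Hypotheses (nA : normal_in A L) (nB : normal_in B L).
Hypothesis cAB : forall a b, A a -> B b -> commute b a.
Hypothesis nAB : ~ (A `<=` B).

(** The elements of [A] in [H_ n] that are central modulo [B].  The sequence is
    not monotone: an element may fail to be in [H_ n], or may fail to commute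
    modulo [B] with a later term of the chain. *)
Let Z_ n := [set x | [/\ A x, H_ n x & forall h, H_ n h -> B [~ x, h]]].
Let K := gen (\bigcup_n Z_ n).

Lemma sg_Z n : is_subgroup (Z_ n).
Proof.
have nBn : normal_in B (H_ n) by apply: normal_sub nB; apply: union_sub.
apply/subgroupP; split=> [|x y [Ax Hx Bx] [Ay Hy By]].
  by split; [apply: sg1|apply: sg1|move=> h _; rewrite comm1g; apply: sg1].
split; [exact: sgF|exact: sgF|move=> h Hh].
by case: (@sgF _ _ x y (sg_comm_l h sB (sH n) nBn)) => //; split; auto.
Qed.

Lemma sub_Z n : Z_ n `<=` K.
Proof. by move=> x Zx; apply: sub_gen; exists n. Qed.

Lemma K_sub : K `<=` A.
Proof. by apply: gen_min => // x [n _ []]. Qed.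

Lemma K_abelian_mod x y : K x -> K y -> B [~ x, y].
Proof.
have ZL : \bigcup_n Z_ n `<=` L by move=> z [n _ [Az _ _]]; apply: AL.
apply: (comm_gen sB sg_union nB ZL ZL) => {}x {}y [m _ Zx] [n _ Zy].
have [[_ Hx Bx] [_ Hy By]] := (Zx, Zy).
have [mn|/ltnW nm] := leqP m n; last by apply: Bx; apply: chain_mono Hy.
by rewrite -invgR; apply: sgV => //; apply: By; apply: chain_mono Hx.
Qed.

(** [K] is nilpotent of class at most two. *)
Lemma acc_K : acc K.
Proof.
have sK : is_subgroup K by apply: sg_gen.
apply: acc_nilpotent => //; apply/nilpotentP => //.
apply: (hypercentralS (B := B `&` K)) => //.
  apply: (hypercentralS (B := [set 1])); [exact: hypercentral1|exact: sgI|].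
  by move=> b x [Bb _] Kx; apply/eqP/commgP/cAB => //; apply: K_sub.
by move=> x y Kx Ky; split; [apply: K_abelian_mod|exact: (sgR sK)].
Qed.

Lemma Z_torsion n p : (forall y, Z_ n y -> B (y ^+ p) -> B y) ->
  forall x, A x -> H_ n x ->
  (B (x ^+ p) -> B x) /\ (Z_ n (x ^+ p) -> Z_ n x).
Proof.
move=> tf x Ax Hx; have HL : H_ n `<=` L by apply: union_sub.
have nH : normal_in (H_ n) (H_ n) by apply: normal_self.
pose uc := upper_central (A `&` H_ n) (B `&` H_ n) (H_ n).
have ucZ y : uc 1%N y <-> Z_ n y.
  split=> [[[Ay Hy] By]|[Ay Hy By]]; split=> //.
  - by move=> h /By[].
  - by move=> h Hh; split; [apply: By|apply: sgR].
have torsion j : uc j (x ^+ p) -> uc j x.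
  apply: upper_central_torsion => //; try exact: sgI.
  - by move=> y [By Hy]; split=> //; apply: BA.
  - exact: normal_inI (normal_sub HL nA) nH.
  - exact: normal_inI (normal_sub HL nB) nH.
  - by move=> y /ucZ Zy [Byp _]; split; [apply: tf|case: Zy].
split=> [Bx|/ucZ/torsion/ucZ //].
by have [|//] := torsion 0%N; split=> //; apply: sgX.
Qed.

(** Since [K] is noetherian, it is contained in some [H_ m]; from then on only
    the second reason for an element to leave [Z_ n] remains. *)
Lemma Z_stable : exists N : nat,
  [/\ forall n, (N <= n)%N -> ~ (Z_ n `<=` B),
      forall m n, (N <= m)%N -> (m <= n)%N -> Z_ n `<=` Z_ m
    & forall n, (N <= n)%N -> B `&` K `<=` Z_ n].
Proof.
have sK : is_subgroup K by apply: sg_gen.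
have [||m Km] := @noetherian_chain _ _ (fun n => K `&` H_ n) acc_K.
- by move=> n; split; [apply: sgI|move=> x []].
- by move=> n x [Kx Hx]; split=> //; apply: HS.
have KH x n : (m <= n)%N -> K x -> H_ n x.
  move=> mn Kx; have [i _ Hx] := AL (K_sub Kx).
  by apply: (chain_mono mn); case: (Km i x).
have [a [Aa nBa]] := nsubset_witness nAB.
have [k _ Ha] := AL Aa.
exists (maxn m k); split=> [n|i j|n]; rewrite geq_max => /andP[mn kn].
- have HL : H_ n `<=` L by apply: union_sub.
  have [|||||b [[Ab Hb] nBb Bb]] :=
    @hypercentral_witness _ (H_ n) (H_ n) (A `&` H_ n) (B `&` H_ n).
  + exact: sgI.
  + exact: sgI.
  + exact: normal_inI (normal_sub HL nA) (normal_self (sH n)).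
  + exact/nilpotentP.
  + move=> AB; apply: nBa; have Hna := chain_mono kn Ha.
    by case: (AB a).
  move=> ZB; apply: nBb; split=> //; apply: ZB; split=> // h /Bb[] //.
- move=> ij x Zx; have [Ax Hx Bx] := Zx; split=> //.
    by apply: KH => //; apply: sub_Z Zx.
  by move=> h Hh; apply: Bx; apply: chain_mono Hh.
move=> b [Bb Kb]; split; [exact: BA|exact: KH|].
by move=> h Hh; apply: (normal_R sB nB) => //; apply: union_sub Hh.
Qed.

Lemma central_factor : exists b, [/\ A b, ~ B b & forall t, L t -> B [~ b, t]].
Proof.
have sK : is_subgroup K by apply: sg_gen.
have [N [nZB dZ BZ]] := Z_stable.
suff [J_ [sJ [JZ [dJ [BJ [nJB tf]]]]]] : exists J_ : nat -> set G,
    (forall n, is_subgroup (J_ n)) /\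
    (forall n, J_ n `<=` Z_ (N + n)) /\
    (forall m n, (m <= n)%N -> J_ n `<=` J_ m) /\
    (forall n, B `&` K `<=` J_ n) /\
    (forall n, ~ (J_ n `<=` B)) /\
    (forall m n k x, J_ m x -> ~ J_ n x -> (0 < k)%N -> J_ n (x ^+ k) ->
      B (x ^+ k)).
  have [||||||||||b [nBb Jb]] := @descending_intersection K B J_ => //.
  - exact: acc_K.
  - exact: K_abelian_mod.
  - by move=> n x /JZ; apply: sub_Z.
  exists b; split=> //; first by have [] := JZ _ _ (Jb 0%N).
  move=> t [n _ Ht]; have [_ _] := JZ _ _ (Jb n); apply.
  by apply: chain_mono Ht; apply: leq_addl.
(* Either elements of some prime order [p] modulo [B] occur in all terms, and
   they form the descending chain, or [A] has no torsion modulo [B]. *)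
have [[p [prp tor]]|notor] := pselect (exists p, prime p /\
    forall n, exists x, [/\ Z_ (N + n) x, ~ B x & B (x ^+ p)]).
  exists (fun n => Z_ (N + n) `&` [set x | K x /\ B (x ^+ p)]).
  split=> [n|].
    apply: sgI; first exact: sg_Z.
    by apply: sg_exponent_mod => //;
      [exact: K_abelian_mod|move=> x b /K_sub; apply: cAB].
  split=> [n x []//|]; split=> [m n mn x [Zx Bx]|].
    by split=> //; apply: dZ Zx; rewrite ?leq_addr ?leq_add2l.
  split=> [n x BKx|].
    by split; [apply: BZ BKx; apply: leq_addr|
      case: BKx => Bx Kx; split=> //; apply: sgX].
  split=> [n ZB|m n k x [Zx [Kx Bxp]] nJx k0 [Zxk _]].
    by have [x [Zx nBx Bxp]] := tor n; apply: nBx; apply: ZB; split=> //;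
      split=> //; apply: sub_Z Zx.
  have [/dvdnP[q ->]|npk] := boolP (p %| k); first by rewrite mulnC expgnA;
    apply: sgX.
  case: nJx; split=> //.
  (* As [k] and [p] are coprime, [x] is in the group generated by [x ^+ k] and
     [x ^+ p], against [nJx]. *)
  have: coprime k p by rewrite coprime_sym prime_coprime.
  rewrite /coprime => /eqP ckp; have := egcdnP p k0; case=> u v Euv _.
  apply: (sgMl (sg_Z (N + n)) (x := x ^+ (v * p))).
    apply: BZ; first exact: leq_addr.
    by split; [rewrite mulnC expgnA; apply: sgX|exact: (sgX _ sK)].
  rewrite -expgSr -addn1 -ckp -Euv mulnC expgnA;
    exact: (@sgX _ (Z_ (N + n)) _ _ (@sg_Z _) Zxk).
exists (fun n => Z_ (N + n)).
split=> [n|]; first exact: sg_Z.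
split=> [n //|]; split=> [m n mn|].
  by apply: dZ; rewrite ?leq_addr ?leq_add2l.
split=> [n|]; first by apply: BZ; apply: leq_addr.
split=> [n|m n k x Zx nZx k0 Zxk]; first by apply: nZB; apply: leq_addr.
have noptor p y : prime p -> A y -> B (y ^+ p) -> B y.
  move=> prp Ay Byp; apply: contrapT => nBy; apply: notor; exists p;
    split=> // j.
  have [i _ Hy] := AL Ay.
  apply: contrapT => notorj; apply: nBy; pose l := maxn (N + j) i.
  suff tf z : Z_ l z -> B (z ^+ p) -> B z.
    have Hly : H_ l y by apply: chain_mono Hy; apply: leq_maxr.
    by have [/(_ Byp)] := Z_torsion tf Ay Hly.
  move=> Zz Bz; apply: contrapT => nBz; apply: notorj; exists z; split=> //.
  by apply: dZ Zz; rewrite ?leq_addr ?leq_maxl.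
case: nZx; have [mn|/ltnW nm] := leqP m n; last first.
  by apply: dZ Zx; rewrite ?leq_addr ?leq_add2l.
have [Ax Hx _] := Zx; have {}Hx : H_ (N + n) x.
  by apply: chain_mono Hx; rewrite leq_add2l.
(* Remove the prime factors of the exponent [k] one at a time. *)
elim/ltn_ind: k k0 x Ax Hx {Zx} Zxk => k IH k0 x Ax Hx Zxk.
have [k1|] := ltnP 1%N k;
  last by rewrite leq_eqVlt ltnS leqNgt k0 orbF => /eqP k1; move: Zxk;
    rewrite k1.
have prp := pdiv_prime k1; have q0 : (0 < k %/ pdiv k)%N.
  by rewrite divn_gt0 ?prime_gt0 // dvdn_leq // pdiv_dvd.
apply: (IH (k %/ pdiv k)) => //; first by rewrite ltn_Pdiv // prime_gt1.
have [|||_] := @Z_torsion (N + n) (pdiv k) _ (x ^+ (k %/ pdiv k)).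
- by move=> y [Ay _ _]; apply: noptor.
- exact: sgX.
- exact: sgX.
- by apply; rewrite -expgnA divnK // pdiv_dvd.
Qed.

End Factor.

Lemma union_central_factors : has_central_factors L.
Proof. by move=> *; apply: central_factor. Qed.

Lemma acc_union : acc L.
Proof. by apply: acc_central_factors => //;
  [exact: sg_union|exact: union_central_factors]. Qed.

End Chains.

(** A chain of nilpotent subgroups is a chain of subgroups of its union. *)
Lemma noetherian_nilpotent (G : groupType) :
  noetherian (fun X : set G => is_subgroup X /\ is_abelian X) ->
  noetherian (fun X : set G => is_subgroup X /\ is_nilpotent X).
Proof.
move=> maxG; apply: noetherian_of_chains => X_ FX SX.
have sX n : is_subgroup (X_ n) by have [] := FX n.
have nX n : is_nilpotent (X_ n) by have [] := FX n.
have [||m maxm] := noetherian_chain (acc_union maxG sX nX SX) (X_ := X_) => //.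
  by move=> n; split=> //; apply: union_sub.
exists m => n mn; apply/seteqP; split; first exact: maxm.
exact: chain_mono mn.
Qed.

(** * Randomly power Engel elements *)

Section RandomlyPowerEngel.
Variable G : groupType.
Implicit Types (a b c g h t u v w x y z : G) (s : seq G).
Implicit Types (A B C H I K L M N S T U V X Y Z : set G).

Lemma lncommJ a s g : lncomm a s ^ g = lncomm (a ^ g) [seq b ^ g | b <- s].
Proof. by elim: s a => [|b s IH] a //=;
  rewrite /lncomm /= -/(lncomm _ _) IH conjRg. Qed.

Lemma eq_cycJ a b h : cyc a = cyc b -> cyc (a ^ h) = cyc (b ^ h).
Proof.
suff sub x y : cyc x = cyc y -> cyc (x ^ h) `<=` cyc (y ^ h).
  by move=> eab; apply/seteqP; split; apply: sub.
move=> exy; apply: cyc_min; first exact: sg_gen.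
have: cyc y x by rewrite -exy; apply: cyc_refl.
have sub : cyc y `<=` [set z | cyc (y ^ h) (z ^ h)].
  apply: cyc_min; last exact: cyc_refl.
  apply/subgroupP; split=> [|z t Cz Ct] /=; first by rewrite conj1g;
    exact: sg1 (sg_gen _).
  by rewrite conjMg conjVg; exact: sgF (sg_gen _) Cz Ct.
exact: sub.
Qed.

(** Both alternatives of the definition, transported by a conjugation, become
    symmetric in two conjugates of [a]. *)
Lemma randomly_power_Engel_pair a h k : randomly_power_Engel a ->
  exists z s, lncomm z s = 1 /\
   ((cyc z = cyc (a ^ h) /\ forall b, b \in s -> cyc b = cyc (a ^ k)) \/
    (cyc z = cyc (a ^ k) /\ forall b, b \in s -> cyc b = cyc (a ^ h))).
Proof.
move=> /(_ (h * k^-1))[a1 [s [gen_s]]].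
have cyc_s b l : b \in a1 :: s -> cyc (b ^ l) = cyc (a ^ l).
  by move=> /gen_s[_]; apply: eq_cycJ.
have kE b : (b ^ (h * k^-1)) ^ k = b ^ h by rewrite -conjgM mulgVK.
case=> /(congr1 (conjg^~ k)); rewrite lncommJ conj1g => s1.
  exists (a1 ^ h), [seq b ^ k | b <- s]; rewrite -{1}kE; split=> //; left.
  split=> [|_ /mapP[b bs ->]]; apply: cyc_s; rewrite inE ?eqxx //.
  by rewrite bs orbT.
exists (a1 ^ k), [seq b ^ h | b <- s]; split; last right.
  by move: s1; rewrite -map_comp; congr (lncomm _ _ = _); apply: eq_map => b /=.
split=> [|_ /mapP[b bs ->]]; apply: cyc_s; rewrite inE ?eqxx //.
by rewrite bs orbT.
Qed.

(** A sequence of power commutators that starts outside [B] and ends in [B]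
    has a last term outside [B]; that term commutes modulo [B] with some
    generator of [cyc x], hence with [x]. *)
Lemma last_outside B C T x s z : is_subgroup B -> is_subgroup C ->
  is_subgroup T -> normal_in B T -> normal_in C T -> T x ->
  (forall b, b \in s -> cyc b = cyc x) -> C z -> ~ B z -> B (lncomm z s) ->
  exists c, [/\ C c, ~ B c & B [~ c, x]].
Proof.
move=> sB sC sT nB nC Tx; elim: s z => [|y s IH] z gen_s Cz nBz Bzs //.
have cyx : cyc y = cyc x by apply: gen_s; rewrite inE eqxx.
have Ty : T y by apply: eq_cyc_in Tx.
have [Bzy|nBzy] := pselect (B [~ z, y]).
  exists z; split=> //.
  by case: (eq_cyc_in (sg_comm_r z sB sT nB) cyx).
apply: (IH [~ z, y]) => //; last exact: (normal_R sC nC).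
by move=> b bs; apply: gen_s; rewrite inE bs orbT.
Qed.

(** If [c] is in [C] and outside [B], and [z] generates [cyc x], then
    [[z ^ c, y]] and [[z, c, y]] agree for [y] in [cyc x], as [z] and [y]
    commute: the commutator sequence of [x] becomes one that starts in [C]. *)
Lemma randomly_power_Engel_centralises a B C T x h :
  randomly_power_Engel a -> x = a ^ h ->
  is_subgroup B -> is_subgroup C -> is_subgroup T ->
  normal_in B T -> normal_in C T -> C `<=` T -> T x -> ~ (C `<=` B) ->
  exists c, [/\ C c, ~ B c & B [~ c, x]].
Proof.
move=> rpa xE sB sC sT nB nC CT Tx nCB.
have [b [Cb nBb]] := nsubset_witness nCB.
have [g [z [s [Cg nBg zs [cz cs]]]]] : exists g z s, [/\ C g, ~ B g,
    lncomm (z ^ g) s = 1 & cyc z = cyc x /\ forall y, y \in s -> cyc y = cyc x].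
  have [z [s [zs [[cz cs]|[cz cs]]]]] :=
    randomly_power_Engel_pair (h * b) h rpa.
    exists b, (z ^ b^-1), s; rewrite conjgKV; split=> //; split;
      last by rewrite xE.
    by rewrite (eq_cycJ b^-1 cz) xE conjgM conjgK.
  exists b^-1, z, [seq y ^ b^-1 | y <- s]; split.
  - exact: sgV.
  - by move=> /(sgV sB); rewrite invgK.
  - by rewrite -lncommJ zs conj1g.
  - rewrite xE; split=> // _ /mapP[y /cs cy ->].
    by rewrite (eq_cycJ b^-1 cy) conjgM conjgK.
have Tg := CT _ Cg; have Tz : T z by apply: eq_cyc_in Tx.
have [Bgz|nBgz] := pselect (B [~ g, z]).
  by exists g; split=> //; case: (eq_cyc_in (sg_comm_r g sB sT nB) cz).
have nBzg : ~ B [~ z, g] by rewrite -invgR => /(sgV sB); rewrite invgK.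
have Czg : C [~ z, g] by apply: (normal_Rl sC nC).
case: s => [|y s] in zs cs *.
  (* Here [z ^ g = 1], so that [z = 1]. *)
  by case: nBzg; rewrite commgEl [z ^ g]zs mulg1 -(conjgK g z) [z ^ g]zs conj1g
    invg1; apply: sg1.
apply: (last_outside sB sC sT nB nC Tx cs Czg nBzg).
suff -> : lncomm [~ z, g] (y :: s) = lncomm (z ^ g) (y :: s) by rewrite zs;
  apply: sg1.
rewrite /lncomm /=; congr foldl.
have czy : [~ z, y] = 1.
  apply/eqP/commgP.
  have /abelianP : is_abelian (cyc x) by apply: abelian_gen => _ _ -> ->.
  by apply; [rewrite -cz|rewrite -(cs y) ?inE ?eqxx //]; apply: cyc_refl.
have -> : z ^ g = z * [~ z, g] by gsimpl.
have -> : [~ z * [~ z, g], y] = [~ z, y] ^ [~ z, g] * [~ [~ z, g], y].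
  by move: [~ z, g] => w; gsimpl.
by rewrite czy conj1g mul1g.
Qed.

Hypothesis maxG : noetherian (fun X : set G => is_subgroup X /\ is_abelian X).

(** A maximal [B] on which the whole group acts nilpotently is all of [N]:
    otherwise the centre of [N / B] contains an element [c], outside [B], that
    [x] centralises modulo [B], and [adjoin B c] is larger. *)
Lemma nilpotent_adjoin a h N : randomly_power_Engel a -> is_subgroup N ->
  is_nilpotent N -> normaliser N (a ^ h) -> is_nilpotent (adjoin N (a ^ h)).
Proof.
move=> rpa sN nilN; set x := a ^ h => nNx; pose T := adjoin N x.
have sT : is_subgroup T by apply: sg_adjoin.
have NT : N `<=` T by apply: adjoin_sub.
have Tx : T x by apply: adjoin_mem.
have nN : normal_in N T.
  apply: normal_normaliser; apply: adjoin_min => //; last exact: sub_normaliser.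
  exact: sg_normaliser.
suff hN : hypercentral T N.
  apply/(nilpotentP sT); apply: (hypercentralS hN sT).
  apply: (@comm_gen _ N T) => //; try by move=> y [/NT|->].
  move=> y z [Ny|->] [Nz|->].
  - exact: sgR.
  - exact: (normal_R sN nN).
  - exact: (normal_Rl sN nN).
  - by rewrite commgg; apply: sg1.
pose P B := [/\ is_subgroup B, B `<=` N, normal_in B T & hypercentral T B].
have [||B [[sB BN nB hB] maxB]] := acc_nilpotent maxG sN nilN (P := P).
- by move=> X [].
- exists [set 1]; split; [exact: sg_trivial|by move=> _ ->; exact: sg1| |].
    exact: normal_trivial.
  exact: hypercentral1.
have [NB|nNB] := pselect (N `<=` B).
  by have <- : B = N by apply/seteqP.
pose C := [set c | N c /\ forall y, N y -> B [~ c, y]].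
have sC : is_subgroup C.
  apply/subgroupP; split=> [|y z [Ny By] [Nz Bz]].
    by split=> [|y _]; [apply: sg1|rewrite comm1g; apply: sg1].
  split=> [|t Nt]; first exact: sgF.
  case: (@sgF _ _ y z (sg_comm_l t sB sN (normal_sub NT nB))) => //; split;
    auto.
have nC : normal_in C T.
  move=> y g [Ny By] Tg; split=> [|t Nt]; first exact: nN.
  rewrite -(conjgKV g t) -conjRg; apply: nB => //; apply: By.
  by apply: nN => //; exact: (sgV sT).
have nCB : ~ (C `<=` B).
  have [b [Nb nBb Bb]] : exists b, [/\ N b, ~ B b & forall t, N t ->
    B [~ b, t]].
    have hNN := iffLR (nilpotentP sN) nilN.
    by apply: (hypercentral_witness sB sN _ hNN); rewrite ?setIid //;
      apply: normal_self.
  by move=> CB; apply: nBb; apply: CB; split.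
have CT : C `<=` T by move=> y [/NT].
have [c [[Nc Bc] nBc Bcx]] :=
  randomly_power_Engel_centralises rpa (erefl x) sB sC sT nB nC CT Tx nCB.
have BcT t : T t -> B [~ c, t].
  suff: T `<=` [set t | T t /\ B [~ c, t]] by move=> /[apply] -[].
  apply: adjoin_min; [exact: sg_comm_r| |by []].
  by move=> y Ny; split; [apply: NT|apply: Bc].
case: nBc; apply: (maxB (adjoin B c) _ _ _ (@adjoin_mem _ B c));
  last exact: adjoin_sub.
have nB' : normal_in (adjoin B c) T by apply: normal_adjoin => //; apply: NT.
split=> //; [exact: sg_adjoin|exact: adjoin_min|].
apply: (hypercentralS hB (sg_adjoin _ _)) => y t B'y Tt.
suff sub : adjoin B c `<=` [set y | T y /\ B [~ y, t]] by case: (sub y B'y).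
apply: adjoin_min; [exact: sg_comm_l| |by split; [apply: NT|apply: BcT]].
by move=> b Bb; split; [apply: NT; apply: BN|apply: (normal_R sB nB)].
Qed.

End RandomlyPowerEngel.

(** * Maximal nilpotent subgroups generated by conjugates *)

Section MaximalNilpotent.
Variable G : groupType.
Implicit Types (g h t u v w x y z : G) (s : seq G).
Implicit Types (B C H I K L M N S T U V X Y Z : set G).

Definition setconj X g : set G := [set x | X (x ^ g^-1)].

Lemma setconjJ X g x : X x -> setconj X g (x ^ g).
Proof. by move=> Xx; rewrite /setconj /= conjgK. Qed.

Lemma sg_setconj X g : is_subgroup X -> is_subgroup (setconj X g).
Proof.
move=> sX; apply/subgroupP; split=> [|x y Xx Xy];
  first by rewrite /setconj /= conj1g; apply: sg1.
by rewrite /setconj /= conjMg conjVg; apply: sgF.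
Qed.

Lemma hypercentral_setconj T Z g : hypercentral T Z ->
  hypercentral (setconj T g) (setconj Z g).
Proof.
elim=> [|B C _ IH sC BC].
  have -> : setconj [set 1] g = [set 1]; last exact: hypercentral1.
  apply/seteqP; split=> x /=; last by move=> ->; rewrite /setconj /= conj1g.
  by rewrite /setconj /= => xg; rewrite -(conjgKV g x) xg conj1g.
apply: (hypercentralS IH (sg_setconj g sC)) => c t Cc Tt.
by rewrite /setconj /= conjRg; apply: BC.
Qed.

Variable a : G.
Hypothesis rpa : randomly_power_Engel a.
Hypothesis maxG : noetherian (fun X : set G => is_subgroup X /\ is_abelian X).

Let A : set G := [set x | exists h, x = a ^ h].

Let AJ x g : A x -> A (x ^ g).
Proof. by move=> [h ->]; exists (h * g); rewrite conjgM. Qed.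

Let nilpotent_class_generated X :=
  [/\ is_subgroup X, is_nilpotent X & X `<=` gen (A `&` X)].

Let maximal V := nilpotent_class_generated V /\
  forall Y, nilpotent_class_generated Y -> V `<=` Y -> Y `<=` V.

Lemma exists_maximal X : nilpotent_class_generated X ->
  exists V, maximal V /\ X `<=` V.
Proof.
move=> FX; pose P Y := nilpotent_class_generated Y /\ X `<=` Y.
have [||V [[FV XV] maxV]] := noetherian_nilpotent maxG (P := P).
- by move=> Y [[sY nY _] _].
- by exists X; split.
exists V; split=> //; split=> // Y FY VY; apply: maxV => //.
by split=> //; apply: subset_trans VY.
Qed.

Lemma nilpotent_class_generated_adjoin X x : nilpotent_class_generated X ->
  A x ->
  normaliser X x -> nilpotent_class_generated (adjoin X x).
Proof.
move=> [sX nX XA] Ax nXx; split; first exact: sg_adjoin.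
  by case: Ax nXx => h ->; apply: nilpotent_adjoin.
apply: adjoin_min; first exact: sg_gen.
  apply: subset_trans XA _; apply: gen_mono => y [Ay Xy]; split=> //.
  exact: adjoin_sub.
by apply: sub_gen; split=> //; apply: adjoin_mem.
Qed.

Lemma maximal_absorbs V x : maximal V -> A x -> normaliser V x -> V x.
Proof.
move=> [FV maxV] Ax nVx.
apply: (maxV (adjoin V x) _ _ _ (@adjoin_mem _ V x)); last exact: adjoin_sub.
exact: nilpotent_class_generated_adjoin.
Qed.

Lemma nilpotent_class_generated_conj X g : nilpotent_class_generated X ->
  nilpotent_class_generated (setconj X g).
Proof.
move=> [sX nX XA]; have sXg := sg_setconj g sX; split=> //.
  by apply/(nilpotentP sXg)/hypercentral_setconj/nilpotentP.
have sub : gen (A `&` X) `<=` setconj (gen (A `&` setconj X g)) g^-1.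
  apply: gen_min; first exact/sg_setconj/sg_gen.
  move=> y [Ay Xy]; rewrite /setconj /= invgK; apply: sub_gen.
  by split; [apply: AJ|apply: setconjJ].
by move=> x /XA/sub; rewrite /setconj /= invgK conjgKV.
Qed.

Lemma maximal_conj V g : maximal V -> maximal (setconj V g).
Proof.
move=> [FV maxV]; split=> [|Y FY VY x Yx];
  first exact: nilpotent_class_generated_conj.
apply: (maxV (setconj Y g^-1) _ _ (x ^ g^-1));
  first exact: nilpotent_class_generated_conj.
  by move=> y Vy; rewrite /setconj /= invgK; apply: VY; apply: setconjJ.
by rewrite /setconj /= invgK conjgKV.
Qed.

(** The normaliser condition with a witness in the class [A].  Were there none,
    the elements of [A] in [M], the normaliser of [I] in [U], would be those in
    [I]; as they generate [I], the normaliser of [M] would normalise [I]. *)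
Lemma class_normaliser I U : is_subgroup I -> I `<=` gen (A `&` I) ->
  I `<=` U ->
  nilpotent_class_generated U -> ~ (U `<=` I) ->
  exists u, [/\ A u, U u, ~ I u & normaliser I u].
Proof.
move=> sI IA IU [sU nU UA] nUI; apply: contrapT => no.
have AI u : A u -> U u -> normaliser I u -> I u.
  by move=> Au Uu nIu; apply: contrapT => nIx; apply: no; exists u.
pose M := U `&` normaliser I.
have sM : is_subgroup M by apply: sgI (sg_normaliser I).
have IM : I `<=` M by move=> i Ii; split; [apply: IU|apply: sub_normaliser].
have nUM : ~ (U `<=` M).
  move=> UM; apply: nUI => x /UA; apply: gen_min x => // x [Ax Ux].
  by apply: AI => //; case: (UM x Ux).
have [|y [Uy nMy nNy]] := nilpotent_normaliser sM sU nU _ nUM;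
  first by move=> x [].
apply: nMy; split=> //.
have AIM z : (forall m, M m -> M (m ^ z)) -> I `<=` setconj I z^-1.
  move=> Mz x /IA; apply: gen_min x; first exact: sg_setconj.
  move=> x [Ax Ix]; rewrite /setconj /= invgK.
  by have [Ux nx] := Mz x (IM x Ix); apply: AI => //; apply: AJ.
move=> x Ix; split.
  by have := AIM y (fun m Mm => proj1 (nNy m Mm)) x Ix;
    rewrite /setconj /= invgK.
by have := AIM y^-1 (fun m Mm => proj2 (nNy m Mm)) x Ix;
  rewrite /setconj /= !invgK.
Qed.

Section LargestIntersection.
Variable I : set G.
Hypotheses (sI : is_subgroup I) (IA : I `<=` gen (A `&` I)).
Hypothesis maxI : forall U V, maximal U -> maximal V -> ~ (U `<=` V) ->
  I `<=` gen (A `&` (U `&` V)) -> gen (A `&` (U `&` V)) `<=` I.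

(** By induction on [s], reduce to [z] outside the normaliser of [V] with
    [[z, b]] inside it, where [b] generates [cyc v].  Then [b ^ z] normalises
    [V], hence so does [v ^ z], which is therefore in [V] and in its conjugate
    by [z] but not in [I]. *)
Lemma engel_sequence_contradiction V v s z : maximal V -> I `<=` V -> A v ->
  V v ->
  ~ I v -> normaliser I v -> normaliser I z -> ~ normaliser V z ->
  (forall b, b \in s -> cyc b = cyc v) -> lncomm z s <> 1.
Proof.
move=> mV IV Av Vv nIv nv; have [[sV nilV VA] maxV] := mV.
have sNI := sg_normaliser I; have sNV := sg_normaliser V.
elim: s z => [|b s IH] z nz nVz gen_s.
  by move=> /= z1; apply: nVz; rewrite z1; apply: sg1.
have bv : cyc b = cyc v by apply: gen_s; rewrite inE eqxx.
have gen_s' c : c \in s -> cyc c = cyc v.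
  by move=> cs; apply: gen_s; rewrite inE cs orbT.
have nb : normaliser I b by apply: normaliser_eqcyc nv.
have [nVzb|nVzb] := pselect (normaliser V [~ z, b]); last first.
  by apply: (IH [~ z, b]) => //; apply: (sgR sNI).
exfalso; have Vb : V b by apply: eq_cyc_in Vv.
have nVbz : normaliser V (b ^ z).
  have -> : b ^ z = b * [~ z, b]^-1 by gsimpl.
  by apply: (sgM sNV); [apply: sub_normaliser|apply: (sgV sNV)].
have Vvz : V (v ^ z).
  apply: maximal_absorbs => //; first exact: AJ.
  by apply: normaliser_eqcyc nVbz; apply: eq_cycJ.
have [VVz|nVVz] := pselect (V `<=` setconj V z).
  have VzV := maxV _ (nilpotent_class_generated_conj z (proj1 mV)) VVz.
  by apply: nVz => y Vy; split; [apply: VzV; apply: setconjJ|exact: VVz].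
have Ivz : I (v ^ z).
  apply: (maxI mV (maximal_conj z mV) nVVz).
    move=> x /IA; apply: gen_mono => y [Ay Iy]; split=> //.
    by split; apply: IV => //; have [] := nz y Iy.
  by apply: sub_gen; split; [apply: AJ|split=> //; apply: setconjJ].
by apply: nIv; have [_] := nz _ Ivz; rewrite conjgK.
Qed.

(** [U] and [V] play symmetric roles, so either alternative of
    [randomly_power_Engel_pair] leads to the same contradiction. *)
Lemma no_distinct_maximal U V : maximal U -> maximal V -> ~ (U `<=` V) ->
  I = gen (A `&` (U `&` V)) -> False.
Proof.
move=> mU mV nUV IE.
have [[sU _ UA] maxU] := mU; have [[sV _ VA] maxV] := mV.
have IU : I `<=` U by rewrite IE; apply: gen_min => // x [_ []].
have IV : I `<=` V by rewrite IE; apply: gen_min => // x [_ []].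
have nVU : ~ (V `<=` U) by move=> VU; apply: nUV; apply: (maxV U (proj1 mU)).
have AI x : A x -> U x -> V x -> I x.
  by move=> Ax Ux Vx; rewrite IE; apply: sub_gen.
have [u [Au Uu nIu nu]] :=
  class_normaliser sI IA IU (proj1 mU) (fun UI => nUV (subset_trans UI IV)).
have [v [Av Vv nIv nv]] :=
  class_normaliser sI IA IV (proj1 mV) (fun VI => nVU (subset_trans VI IU)).
have nVu : ~ normaliser V u by move=> nVu; apply: nIu; apply: AI => //;
  apply: maximal_absorbs.
have nUv : ~ normaliser U v by move=> nUv; apply: nIv; apply: AI => //;
  apply: maximal_absorbs.
have [[h uE] [k vE]] := (Au, Av).
have [z [s [zs]]] := randomly_power_Engel_pair h k rpa.
rewrite -uE -vE => -[[zu sv]|[zv su]].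
  apply: (engel_sequence_contradiction mV IV Av Vv nIv nv _ _ sv zs).
    by apply: normaliser_eqcyc nu.
  by move=> nVz; apply: nVu; apply: normaliser_eqcyc nVz.
apply: (engel_sequence_contradiction mU IU Au Uu nIu nu _ _ su zs).
  by apply: normaliser_eqcyc nv.
by move=> nUz; apply: nUv; apply: normaliser_eqcyc nUz.
Qed.

End LargestIntersection.

Lemma maximal_unique U V : maximal U -> maximal V -> U `<=` V.
Proof.
move=> mU mV; apply: contrapT => nUV.
pose P I := exists U V, [/\ maximal U, maximal V, ~ (U `<=` V)
  & I = gen (A `&` (U `&` V))].
have [||I [[U' [V' [mU' mV' nUV' IE]]] maxI]] :=
  noetherian_nilpotent maxG (P := P).
- move=> _ [X [Y [[[sX nX _] _] _ _ ->]]]; split; first exact: sg_gen.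
  by apply: nilpotent_sub nX => //;
    [exact: sg_gen|apply: gen_min => // x [_ []]].
- by exists (gen (A `&` (U `&` V))), U, V.
apply: (@no_distinct_maximal I _ _ _ U' V') => //.
- by rewrite IE; apply: sg_gen.
- rewrite {1}IE; apply: gen_mono => x Ax; split; first by case: Ax.
  by rewrite IE; apply: sub_gen.
- by move=> X Y mX mY nXY IXY; apply: maxI => //; exists X, Y.
Qed.

Lemma randomly_power_Engel_fitting : fitting G a.
Proof.
have F1 : nilpotent_class_generated [set 1].
  split; [exact: sg_trivial| |by move=> _ ->; exact: sg1 (sg_gen _)].
  by apply/(nilpotentP (@sg_trivial G)); apply: hypercentral1.
have Aa : A a by exists 1; rewrite conjg1.
have [|V [mV V1a]] := @exists_maximal (adjoin [set 1] a).
  by apply: nilpotent_class_generated_adjoin => // _ ->; rewrite !conj1g.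
apply: sub_gen; exists V; last by apply: V1a; apply: adjoin_mem.
have [[sV nV _] _] := mV; split=> //.
move=> x g; rewrite !inE => Vx.
apply: (maximal_unique (maximal_conj g mV) mV); exact: setconjJ.
Qed.

End MaximalNilpotent.

(** * Fitting subgroup and left Engel elements *)

Section Fitting.
Variable G : groupType.
Implicit Types (g h t x y : G) (H M N S T X Z : set G).

Lemma sg_lower_central H n : is_subgroup H -> is_subgroup (lower_central H n).
Proof. by case: n => // n _; apply: sg_gen. Qed.

Lemma lower_central_normal H n : normal_in H [set: G] ->
  normal_in (lower_central H n) [set: G].
Proof.
move=> nH; elim: n => [//|n IH]; apply: normal_gen; first exact: sg_setT.
move=> z g [x [y []]]; rewrite !inE => Hx Hy -> _; rewrite conjRg;
  apply: sub_gen.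
by exists (x ^ g), (y ^ g); rewrite !inE; split=> //; [apply: IH|apply: nH].
Qed.

Lemma lower_central_trivial H m n : lower_central H m = [set 1] -> (m <= n)%N ->
  lower_central H n `<=` [set 1].
Proof.
move=> H1 mn; rewrite -(subnKC mn); elim: (n - m)%N => [|k IH].
  by rewrite addn0 H1.
rewrite addnS; apply: gen_min; first exact: sg_trivial.
by move=> z [x [y []]]; rewrite inE => /IH -> _ ->; rewrite comm1g.
Qed.

(** Shifting the index by one makes room for the whole group as a term that
    imposes no constraint. *)
Definition lower_term H n : set G :=
  if n is k.+1 then lower_central H k else [set: G].

Lemma sg_lower_term H n : is_subgroup H -> is_subgroup (lower_term H n).
Proof. by case: n => [|n] sH; [apply: sg_setT|apply: sg_lower_central]. Qed.

Lemma lower_term_normal H n : normal_in H [set: G] ->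
  normal_in (lower_term H n) [set: G].
Proof. by case: n => [|n] nH; [|apply: lower_central_normal]. Qed.

Lemma lower_term_comm H n x t : is_subgroup H -> normal_in H [set: G] ->
  lower_term H n x -> H t -> lower_term H n.+1 [~ x, t].
Proof.
case: n => [|n] sH nH Hx Ht; first exact: (normal_Rl sH nH).
by apply: sub_gen; exists x, t; rewrite !inE.
Qed.

Section Product.
Variables M N : set G.
Hypotheses (sM : is_subgroup M) (sN : is_subgroup N).
Hypotheses (nM : normal_in M [set: G]) (nN : normal_in N [set: G]).

(** The subgroups generated by these intersections form a central series of the
    product, by weight: commutation with [M] raises [i], with [N] it raises
    [j], and a term vanishes once [i] exceeds the class of [M] or [j] that of
    [N]. *)
Let W k := [set x | exists i j,
  (i + j)%N = k /\ lower_term M i x /\ lower_term N j x].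

Lemma weight_normal k : normal_in (gen (W k)) [set: G].
Proof.
apply: normal_gen; first exact: sg_setT.
move=> x g [i [j [ijk [Mx Nx]]]] _; apply: sub_gen; exists i, j.
by split=> //; split; apply: lower_term_normal.
Qed.

Lemma weight_comm k x t : gen (W k) x -> gen (M `|` N) t ->
  gen (W k.+1) [~ x, t].
Proof.
apply: (comm_gen (sg_gen _) (@sg_setT G) (@weight_normal _)) => // {}x {}t.
move=> [i [j [ijk [Mx Nx]]]] [Mt|Nt]; apply: sub_gen.
  exists i.+1, j; rewrite addSn ijk; split=> //; split;
    first exact: lower_term_comm.
  by apply: (normal_R (L := [set: G])) => //;
    [apply: sg_lower_term|apply: lower_term_normal].
exists i, j.+1; rewrite addnS ijk; split=> //; split;
  last exact: lower_term_comm.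
by apply: (normal_R (L := [set: G])) => //;
  [apply: sg_lower_term|apply: lower_term_normal].
Qed.

Lemma nilpotent_product : is_nilpotent M -> is_nilpotent N ->
  is_nilpotent (gen (M `|` N)).
Proof.
move=> [c Mc] [d Nd]; set T := gen _; have sT : is_subgroup T by apply: sg_gen.
have hW n k : (n + k)%N = (c + d).+1 -> hypercentral T (gen (W k)).
  elim: n k => [|n IH] k nk.
    have -> : gen (W k) = [set 1]; last exact: hypercentral1.
    apply/seteqP; split=> [|_ ->]; last exact: sg1 (sg_gen _).
    apply: gen_min; first exact: sg_trivial.
    move=> x [i [j [ijk [Mx Nx]]]]; have [ci|ic] := ltnP c i.
      by case: i ci Mx ijk => // i ci Mx _;
        apply: (lower_central_trivial Mc ci).
    have dj : (d < j)%N.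
      by rewrite -(ltn_add2l i) ijk -(add0n k) nk ltnS leq_add2r.
    by case: j dj Nx ijk => // j dj Nx _; apply: (lower_central_trivial Nd dj).
  apply: (hypercentralS (IH k.+1 _) (sg_gen _)); first by rewrite addnS.
  by move=> x t; apply: weight_comm.
apply/(nilpotentP sT); have :=
  hypercentral_sub sT (@subset_refl _ T) (hW (c + d)%N 1%N (addn1 _)).
rewrite setIidr //; apply: gen_min; first exact: sg_gen.
by move=> x [Mx|Nx]; apply: sub_gen; [exists 1%N, 0%N|exists 0%N, 1%N].
Qed.

End Product.

Lemma fittingP x : fitting G x ->
  exists N, [/\ is_subgroup N, normal_in N [set: G], is_nilpotent N & N x].
Proof.
pose F := [set x | exists N, [/\ is_subgroup N, normal_in N [set: G],
  is_nilpotent N & N x]].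
suff: fitting G `<=` F by apply.
apply: gen_min => [|y [N [sN nN nilN] Ny]]; last first.
  by exists N; split=> // z g Nz _; have := nN z g; rewrite !inE; apply.
apply/subgroupP; split.
  exists [set 1]; split; [exact: sg_trivial|exact: normal_trivial| |by []].
  by exists 0%N.
move=> y z [M [sM nM nilM My]] [N [sN nN nilN Nz]]; exists (gen (M `|` N));
  split.
- exact: sg_gen.
- apply: normal_gen; first exact: sg_setT.
  by move=> s g [Ms|Ns] _; apply: sub_gen; [left; apply: nM|right; apply: nN].
- exact: nilpotent_product.
- by apply: sgF (sg_gen _) _ _; apply: sub_gen; [left|right].
Qed.

(** [[a, x]] is already in the nilpotent normal subgroup that contains [x]. *)
Lemma fitting_left_Engel x : fitting G x -> left_Engel x.
Proof.
move=> /fittingP[N [sN nN /(nilpotentP sN) hN Nx]] a.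
suff ends Z : hypercentral N Z -> forall y, Z y ->
  exists k, lncomm y (nseq k x) = 1.
  have [|k xk] := ends N hN [~ a, x]; first exact: (normal_Rl sN nN).
  by exists k.+1.
elim=> [|B C _ IH _ CB] y; first by move=> ->; exists 0%N.
by move=> Cy; have [k yk] := IH _ (CB _ _ Cy Nx); exists k.+1.
Qed.

Lemma left_Engel_randomly_power_Engel x : left_Engel x ->
  randomly_power_Engel x.
Proof.
move=> Lx g; have [k _ xk] := Lx (x ^ g); exists x, (nseq k x); split;
  last by left.
move=> b; rewrite in_cons => /orP[/eqP->|/nseqP[-> _]];
  by split=> //; rewrite inE; apply: cyc_refl.
Qed.

End Fitting.

Theorem theorem2p7 (G : groupType) (maxG : max_abelian_subgroups G) :
  left_Engel_set G = randomly_power_Engel_set G /\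
  randomly_power_Engel_set G = fitting G.
Proof.
have nab : noetherian (fun X : set G => is_subgroup X /\ is_abelian X).
  by apply: noetherian_of_chains => X_; apply: maxG.
have LR : left_Engel_set G `<=` randomly_power_Engel_set G.
  exact: left_Engel_randomly_power_Engel.
have RF : randomly_power_Engel_set G `<=` fitting G.
  by move=> a rpa; apply: randomly_power_Engel_fitting.
have FL : fitting G `<=` left_Engel_set G by exact: fitting_left_Engel.
split; apply/seteqP; split=> //; first exact: subset_trans RF FL.
exact: subset_trans FL LR.
Qed.
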